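(* Let $Q$ be a van Rees loop. For $c\in Q$, define a binary operation $\ast_c$ on $Q$ by $$x \ast_c y = (x/ c)\cdot\bigl[(y/ c)\backslash x\bigr]$$ for all $x,y\in Q$. Then $(Q,\ast_c)$ is a Steiner quasigroup.
   Context: A quasigroup $(Q;\cdot,\backslash,/)$ is a set with three binary operations satisfying $x\backslash (xy)=x(x\backslash y)=y$ and $(xy)/y=(x/y)y=x$; a loop is a quasigroup with a two-sided neutral element $\varepsilon$. Loops $(Q,\cdot)$ and $(P,\circ)$ are isotopic if there are bijections $\alpha,\beta,\gamma:Q\to P$ with $\alpha(x)\circ\beta(y)=\gamma(x\cdot y)$ for all $x,y$. A loop has exponent $3$ if it satisfies $xx\cdot x=x\cdot xx=\varepsilon$ for all $x$. A van Rees loop is a loop $Q$ such that every loop isotopic to $Q$ has exponent $3$. A quasigroup $(Q,\ast)$ is Steiner if it satisfies the identities $x\ast x=x$, $x\ast(y\ast x)=y$ and $x\ast y=y\ast x$. *)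

(* Defs.v *)
From mathcomp Require Import ssreflect ssrfun ssrbool.

Set Implicit Arguments.
Unset Strict Implicit.
Unset Printing Implicit Defensive.

Declare Scope loop_scope.
Delimit Scope loop_scope with loop.

Definition quasigroup_axioms (Q : Type) (mul ldiv rdiv : Q -> Q -> Q) : Prop :=
  [/\ forall x y, ldiv x (mul x y) = y,
      forall x y, mul x (ldiv x y) = y,
      forall x y, rdiv (mul x y) y = x
    & forall x y, mul (rdiv x y) y = x].

Record quasigroup := Quasigroup {
  carrier :> Type;
  mul : carrier -> carrier -> carrier;
  ldiv : carrier -> carrier -> carrier;
  rdiv : carrier -> carrier -> carrier;
  quasigroupP : quasigroup_axioms mul ldiv rdiv
}.

Arguments mul {q} x y.
Arguments ldiv {q} x y.
Arguments rdiv {q} x y.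

Notation "x * y" := (mul x y) : loop_scope.
Notation "x \ y" := (ldiv x y) (at level 40, left associativity) : loop_scope.
Notation "x / y" := (rdiv x y) : loop_scope.

Local Open Scope loop_scope.

Record loop := Loop {
  loop_quasigroup :> quasigroup;
  neutral : loop_quasigroup;
  neutral_l : forall x : loop_quasigroup, neutral * x = x;
  neutral_r : forall x : loop_quasigroup, x * neutral = x
}.

Arguments neutral {l}.

Definition isotopic (Q P : loop) : Prop :=
  exists alpha beta gamma : Q -> P,
    [/\ bijective alpha, bijective beta, bijective gamma
      & forall x y : Q, alpha x * beta y = gamma (x * y)].

Definition exponent3 (Q : loop) : Prop :=
  forall x : Q, (x * x) * x = neutral /\ x * (x * x) = neutral.

Definition van_rees (Q : loop) : Prop :=
  forall P : loop, isotopic Q P -> exponent3 P.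

(* The divisions of a quasigroup are determined by its multiplication, so an
   operation is said to be a quasigroup when divisions for it exist. *)
Definition steiner_quasigroup (Q : Type) (op : Q -> Q -> Q) : Prop :=
  [/\ exists ld rd : Q -> Q -> Q, quasigroup_axioms op ld rd,
      forall x, op x x = x,
      forall x y, op x (op y x) = y
    & forall x y, op x y = op y x].

Definition star (Q : loop) (c x y : Q) : Q := (x / c) * ((y / c) \ x).

(* Main.v *)
Require Import Defs.
From mathcomp Require Import ssreflect ssrfun ssrbool.

(** For [a], [c] in [Q], the principal isotope [x o y = (x / c) * (a \ y)] is a
    loop with neutral element [a * c].  Take [x = u * c], [y = a * c] and put
    [v = a \ x], so that [star c x y = u * v] and [x o x = u * v].  Exponent 3
    of the isotope at [x] then reads [((u * v) / c) * v = y] and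
    [u * (a \ (u * v)) = y].  The second equation says that
    [star c x y = star c y x], and the first that
    [star c (star c x y) x = y]. *)

Local Open Scope loop_scope.

Lemma mulKq (Q : quasigroup) (x y : Q) : x \ (x * y) = y.
Proof. by case: (quasigroupP Q). Qed.

Lemma mulVKq (Q : quasigroup) (x y : Q) : x * (x \ y) = y.
Proof. by case: (quasigroupP Q). Qed.

Lemma mulqK (Q : quasigroup) (x y : Q) : (x * y) / y = x.
Proof. by case: (quasigroupP Q). Qed.

Lemma mulqVK (Q : quasigroup) (x y : Q) : (x / y) * y = x.
Proof. by case: (quasigroupP Q). Qed.

Section PrincipalIsotope.

Variables (Q : loop) (a b : Q).

Definition pi_mul (x y : Q) : Q := (x / b) * (a \ y).
Definition pi_ldiv (x y : Q) : Q := a * ((x / b) \ y).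
Definition pi_rdiv (x y : Q) : Q := (x / (a \ y)) * b.

Lemma pi_quasigroupP : quasigroup_axioms pi_mul pi_ldiv pi_rdiv.
Proof.
by split=> x y; rewrite /pi_mul /pi_ldiv /pi_rdiv
  ?(mulKq, mulVKq, mulqK, mulqVK).
Qed.

Definition pi_quasigroup : quasigroup := Quasigroup pi_quasigroupP.

Lemma pi_neutral_l (x : pi_quasigroup) : (a * b : pi_quasigroup) * x = x.
Proof. by rewrite /= /pi_mul mulqK mulVKq. Qed.

Lemma pi_neutral_r (x : pi_quasigroup) : x * (a * b : pi_quasigroup) = x.
Proof. by rewrite /= /pi_mul mulKq mulqVK. Qed.

Definition principal_isotope : loop := Loop pi_neutral_l pi_neutral_r.

Lemma isotopic_principal : isotopic Q principal_isotope.
Proof.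
(* Right translation by [b] and left translation by [a] cancel the two divisions inside [pi_mul], so
   the third map can be the identity. *)
exists (fun x => x * b), (fun y => a * y), id; split.
- by exists (fun x => x / b) => x; rewrite ?mulqK ?mulqVK.
- by exists (fun y => a \ y) => y; rewrite ?mulKq ?mulVKq.
- by exists id.
- by move=> x y; rewrite /= /pi_mul mulqK mulKq.
Qed.

Lemma van_rees_principal (x : Q) : van_rees Q ->
  pi_mul (pi_mul x x) x = a * b /\ pi_mul x (pi_mul x x) = a * b.
Proof. by move=> hQ; apply: (hQ _ isotopic_principal x). Qed.

End PrincipalIsotope.

Section Star.

Variables (Q : loop) (hQ : van_rees Q) (c : Q).

Lemma star_idem (x : Q) : star c x x = x.
Proof. by rewrite /star mulVKq. Qed.

Lemma starC (x y : Q) : star c x y = star c y x.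
Proof.
have [_] := @van_rees_principal Q (y / c) c x hQ.
rewrite mulqVK /pi_mul -/(star c x y) => eq_y.
(* Only the dividend [y] of [star c y x] is expanded; then [x / c] cancels, and after it [y / c]. *)
by rewrite [RHS]/star -[X in _ = _ * (_ \ X)]eq_y mulKq mulVKq.
Qed.

Lemma star_starl (x y : Q) : star c (star c x y) x = y.
Proof.
have [+ _] := @van_rees_principal Q (y / c) c x hQ.
rewrite mulqVK /pi_mul -/(star c x y) => eq_y.
(* Since [star c x y] has left factor [x / c], dividing it by [x / c] leaves [(y / c) \ x], the
   second factor in [eq_y]. *)
by apply: etrans eq_y; congr (_ * _); apply: mulKq.
Qed.

Lemma starK (x y : Q) : star c x (star c y x) = y.
Proof. by rewrite (starC y x) starC star_starl. Qed.

End Star.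

Theorem theorem11 (Q : loop) (hQ : van_rees Q) (c : Q) :
  steiner_quasigroup (star c).
Proof.
split; last exact: starC.
(* All left and right translations of [star c] are involutions, so [star c] serves as both of its
   own divisions. *)
- have starKl x y : star c x (star c x y) = y by rewrite starC // star_starl.
  have starKr x y : star c (star c x y) y = x by rewrite (@starC Q hQ c x y) star_starl.
  by exists (star c), (star c).
- exact: star_idem.
- exact: starK.
Qed.
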